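(* Let $m$ be a nonnegative integer and $0<q<1$. Then $$\left(\sum_{n=-\infty}^\infty(-1)^nq^{n^2}\right)^{m+2}=\prod_{n=1}^\infty\left(\frac{1-q^n}{1+q^n}\right)^{m+2}=1+2\sum_{n=1}^\infty(-1)^n\;{}_{m+2}\phi_{m+1}\left({q^{-n},q^n,q,\dots,q\atop -q,0,\dots,0};q,q\right),$$ where in the ${}_{m+2}\phi_{m+1}$ the upper parameters are $q^{-n},q^n$ followed by $m$ copies of $q$, and the lower parameters are $-q$ followed by $m$ copies of $0$.
   Context: Put $(x;q)_0=1$, $(x;q)_k=\prod_{i=0}^{k-1}(1-xq^i)$. For a nonnegative integer $n$, the terminating basic hypergeometric series is $${}_{r+1}\phi_r\left({q^{-n},a_2,\dots,a_{r+1}\atop b_1,\dots,b_r};q,z\right)=\sum_{k=0}^n\frac{(q^{-n};q)_k(a_2;q)_k\cdots(a_{r+1};q)_k}{(q;q)_k(b_1;q)_k\cdots(b_r;q)_k}z^k .$$ *)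

(* Defs.v *)
From mathcomp Require Import all_boot all_order all_algebra.
From mathcomp Require Import all_classical all_reals all_analysis.

Set Implicit Arguments.
Unset Strict Implicit.
Unset Printing Implicit Defensive.

Import Order.TTheory GRing.Theory Num.Theory.
Import numFieldNormedType.Exports.

Local Open Scope classical_set_scope.
Local Open Scope ring_scope.

Definition qpoch (R : realType) (x q : R) (k : nat) : R :=
  \prod_(i < k) (1 - x * q ^+ i).

(* Terminating (r+1)phi_r series: q^(-n) is the implicit first upper parameter,
   [a] lists the other r upper parameters and [b] the r lower ones. *)
Definition qhyper (R : realType) (r n : nat) (a b : r.-tuple R) (q z : R) : R :=
  \sum_(k < n.+1)
    (qpoch (q ^- n) q k * \prod_(x <- a) qpoch x q k) /
    (qpoch q q k * \prod_(y <- b) qpoch y q k) * z ^+ k.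

(* Bilateral series: the two ends of the partial sums
   f(-M) + ... + f(-1) + f(0) + ... + f(N-1) tend to infinity independently. *)
Definition has_bilateral_sum (R : realType) (f : int -> R) (s : R) : Prop :=
  (fun p : nat * nat =>
     \sum_(i < p.1) f (- i.+1%:Z) + \sum_(i < p.2) f i%:Z)
    @ filter_prod \oo \oo --> s.

(* Main.v *)
Require Import Defs.
From mathcomp Require Import all_boot all_order all_algebra.
From mathcomp Require Import all_classical all_reals all_analysis.
From mathcomp Require Import ring lra.

Import Order.TTheory GRing.Theory Num.Theory.
Import numFieldNormedType.Exports.

Local Open Scope classical_set_scope.
Local Open Scope ring_scope.

(** The identity is a rational interpolation formula evaluated at -1.  A function
    [f] analytic on the disc [|t| < 1/q] is determined by its values at the
    points [q^k], and it has the Newton-type expansion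
      f(t) = f(1) + sum_(n >= 1) (1 + q^n)
               prod_(0 <= i < n) (t - q^i) / prod_(1 <= i <= n) (1 - q^i t) Phi_n(f),
      Phi_n(f) = sum_(k <= n) (q^-n;q)_k (q^n;q)_k / (q;q)_k^2 q^k f(q^k).
    At [t = -1] the basis function of index [n] is [2 (-1)^n], so that
      f(-1) = f(1) + 2 sum_(n >= 1) (-1)^n Phi_n(f).
    Apply this to the function
      F(t) = prod_(i >= 1) ((1 + q^i t) / (1 + q^i))^c ((1 - q^i) / (1 - q^i t))^d.
    Its values at the nodes telescope to [F(q^k) = (q;q)_k^d / (-q;q)_k^c], so
    [F(1) = 1], while [F(-1)] is the product of the [((1 - q^i) / (1 + q^i))^(c+d)].
    - For [c = 1], [d = m + 1], [Phi_n(F)] is the basic hypergeometric sum of the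
      theorem.
    - For [c = 0], [d = 1], the q-Vandermonde sum gives [Phi_n(F) = q^(n^2)]; this
      is Gauss's product formula for the theta series.

    The expansion is needed only at [t = -1], where an elementary argument
    replaces complex analysis.  Let [newton_rem N f] be the error after [N] terms.
    A contiguity relation between [Phi_n] and [Phi_(n+1)] gives
    [newton_rem_blaschke]: at stage [N] the factor [t - q^N] can be traded for
    [-(1 - q^N t)] at stage [N-1], as for Blaschke products.  This is a recurrence
    for the errors of the monomials, whence
    [|newton_rem N (t^j)| <= M_N w^j] with [M_N -> 0], for any [1 < w < 1/q]
    ([newton_rem_expr_le], [rem_bound_cvg0]).  Therefore
    [|newton_rem N f| <= M_N f(w)] for polynomials with nonnegative coefficients,
    then for their limits, among them the partial products of [F], and
    finally for [F] itself since these products are bounded at [w]. *)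

(** * q-shifted factorials *)

Section QPochhammer.
Context {R : realType}.
Implicit Types (x q : R) (k n : nat).

Lemma qpoch0 x q : qpoch x q 0 = 1.
Proof. by rewrite /qpoch big_ord0. Qed.

Lemma qpochSr x q k : qpoch x q k.+1 = qpoch x q k * (1 - x * q ^+ k).
Proof. by rewrite /qpoch big_ord_recr. Qed.

Lemma qpochSl x q k : qpoch x q k.+1 = (1 - x) * qpoch (x * q) q k.
Proof.
rewrite /qpoch big_ord_recl expr0 mulr1; congr (_ * _).
by apply: eq_bigr => i _; rewrite -mulrA -exprS.
Qed.

Lemma qpoch_0l q k : qpoch 0 q k = 1.
Proof. by rewrite /qpoch big1 // => i _; rewrite mul0r subr0. Qed.

Lemma qpoch_eq0 q n k : q != 0 -> (n < k)%N -> qpoch (q ^- n) q k = 0.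
Proof.
move=> q0 nk; rewrite /qpoch (bigD1 (Ordinal nk)) //=.
by rewrite mulVf ?expf_neq0 // subrr mul0r.
Qed.

End QPochhammer.

(** * The interpolation coefficients and their contiguity relation *)

Section Interpolation.
Context {R : realType} (q : R).
Hypotheses (q_gt0 : 0 < q) (q_lt1 : q < 1).
Implicit Types (f : R -> R) (n N k : nat).

Let q_neq0 : q != 0.
Proof. by rewrite gt_eqF. Qed.

Lemma qX_lt1 n : (0 < n)%N -> q ^+ n < 1.
Proof. by move=> n0; rewrite exprn_ilt1 ?ltW // -lt0n. Qed.

Lemma qpochqq_neq0 k : qpoch q q k != 0.
Proof.
rewrite /qpoch prodf_seq_neq0; apply/allP => i _ /=.
by rewrite -exprS subr_eq0 eq_sym lt_eqF // qX_lt1.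
Qed.

(** The squared [(q;q)_k] is the natural normalisation: with it, constant functions
    have no coefficients of positive index. *)
Definition newton_weight n k : R :=
  qpoch (q ^- n) q k * qpoch (q ^+ n) q k * q ^+ k / qpoch q q k ^+ 2.

Definition newton_coef n f : R :=
  \sum_(k < n.+1) newton_weight n k * f (q ^+ k).

Lemma eq_newton_coef n f g :
  (forall k, f (q ^+ k) = g (q ^+ k)) -> newton_coef n f = newton_coef n g.
Proof. by move=> fg; apply: eq_bigr => k _; rewrite fg. Qed.

(** Both sides come from shifting [q^-n] and [q^n] by one factor of [q]; the
    quotients of shifted factorials then cancel for each [k] separately, so no
    summation formula is involved. *)
Lemma newton_weight_contiguous n k :
  (1 - q ^+ n) * newton_weight n.+1 k * (q ^+ k - q ^+ n.+1) =
  (1 - q ^+ n.+1) * newton_weight n k * (1 - q ^+ n * q ^+ k).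
Proof.
have up : (1 - q ^+ n) * qpoch (q ^+ n.+1) q k =
    qpoch (q ^+ n) q k * (1 - q ^+ n * q ^+ k).
  by rewrite -qpochSr qpochSl exprSr.
have low : qpoch (q ^- n.+1) q k * (q ^+ k - q ^+ n.+1) =
    (1 - q ^+ n.+1) * qpoch (q ^- n) q k.
  have qn0 : q ^+ n.+1 != 0 by rewrite expf_neq0.
  have -> : q ^+ k - q ^+ n.+1 = (1 - q ^- n.+1 * q ^+ k) * - q ^+ n.+1.
    by field.
  rewrite mulrA -qpochSr qpochSl.
  have -> : q ^- n.+1 * q = q ^- n by rewrite exprSr; field; rewrite expf_neq0.
  by field.
rewrite /newton_weight.
transitivity ((1 - q ^+ n) * qpoch (q ^+ n.+1) q k *
    (qpoch (q ^- n.+1) q k * (q ^+ k - q ^+ n.+1)) * q ^+ k / qpoch q q k ^+ 2).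
  by ring.
by rewrite up low; ring.
Qed.

(** The extra term [k = n + 1] on the left vanishes, because [q^(n+1)] is a zero of
    the inserted factor. *)
Lemma newton_coef_contiguous n f :
  (1 - q ^+ n) * newton_coef n.+1 (fun t => (t - q ^+ n.+1) * f t) =
  (1 - q ^+ n.+1) * newton_coef n (fun t => (1 - q ^+ n * t) * f t).
Proof.
rewrite /newton_coef big_ord_recr /= subrr mul0r mulr0 addr0 !mulr_sumr.
apply: eq_bigr => k _.
have := congr1 (fun x => x * f (q ^+ k)) (newton_weight_contiguous n k).
by rewrite -!mulrA.
Qed.

(** The weights have a closed-form antidifference, since the product of [q^-n] and
    [q^n] is 1; at [K = n] it contains the factor [1 - q^-n q^n]
    when [n > 0]. *)
Lemma newton_weight_partial_sum n K :
  \sum_(k < K.+1) newton_weight n k =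
  qpoch (q ^- n * q) q K * qpoch (q ^+ n * q) q K / qpoch q q K ^+ 2.
Proof.
elim: K => [|K IH].
  by rewrite big_ord1 /newton_weight !qpoch0 expr0; field.
rewrite big_ord_recr /= IH /newton_weight !(qpochSl (q ^- n)) !(qpochSl (q ^+ n)).
rewrite !(qpochSr _ _ K).
have Q0 := qpochqq_neq0 K; have := qpochqq_neq0 K.+1.
rewrite qpochSr mulf_eq0 negb_or => /andP[_ Q1].
have qn0 : q ^+ n != 0 by rewrite expf_neq0.
rewrite (exprS q K).
move: (qpoch (q ^- n * q) q K) (qpoch (q ^+ n * q) q K) => A B.
move: (qpoch q q K) (q ^+ n) (q ^+ K) Q0 Q1 qn0 => C x y C0 y1 x0.
by field; rewrite C0 x0 y1.
Qed.

Lemma newton_coef_cst n : (0 < n)%N -> newton_coef n (fun=> 1) = 0.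
Proof.
case: n => // n _; rewrite /newton_coef.
under eq_bigr do rewrite mulr1.
rewrite newton_weight_partial_sum.
have -> : q ^- n.+1 * q = q ^- n by rewrite exprSr; field; rewrite expf_neq0.
by rewrite qpoch_eq0 // !mul0r.
Qed.

(** * The remainder at -1 *)

Definition newton_rem N f : R :=
  f (-1) - f 1 - 2 * \sum_(1 <= n < N.+1) (-1) ^+ n * newton_coef n f.

Lemma eq_newton_rem N f g : f =1 g -> newton_rem N f = newton_rem N g.
Proof.
by move=> fg; rewrite (_ : f = g) //; apply/funext.
Qed.

Lemma newton_rem0 f : newton_rem 0 f = f (-1) - f 1.
Proof. by rewrite /newton_rem big_geq // mulr0 subr0. Qed.

Lemma newton_remS N f :
  newton_rem N.+1 f = newton_rem N f - 2 * (-1) ^+ N.+1 * newton_coef N.+1 f.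
Proof. by rewrite /newton_rem big_nat_recr //=; ring. Qed.

Lemma newton_coef_lin n a b f g :
  newton_coef n (fun t => a * f t + b * g t) =
  a * newton_coef n f + b * newton_coef n g.
Proof.
rewrite /newton_coef !mulr_sumr -big_split /=.
by apply: eq_bigr => k _; ring.
Qed.

Lemma newton_rem_lin N a b f g :
  newton_rem N (fun t => a * f t + b * g t) =
  a * newton_rem N f + b * newton_rem N g.
Proof.
elim: N => [|N IH]; first by rewrite !newton_rem0; ring.
by rewrite !newton_remS IH newton_coef_lin; ring.
Qed.

(** By the contiguity relation, the right-hand side divided by [1 - q^(N+1)] changes
    from [N - 1] to [N] by exactly the new term of [newton_rem]; and [(1 + t) f]
    vanishes at -1, so nothing else remains. *)
Lemma newton_rem_factor N f :
  (1 - q ^+ N.+1) * newton_rem N (fun t => (1 + t) * f t) =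
  2 * (-1) ^+ N.+1 * newton_coef N.+1 (fun t => (t - q ^+ N.+1) * f t).
Proof.
elim: N => [|N IH].
  rewrite newton_rem0 /newton_coef !big_ord_recl big_ord0 /newton_weight /=.
  rewrite !qpoch0 expr0 /bump /= addn0 expr1 subrr mul0r addr0.
  by rewrite !expr1 expr1n divr1; ring.
have qN : 1 - q ^+ N.+1 != 0 by rewrite subr_eq0 eq_sym lt_eqF // qX_lt1.
apply: (mulfI qN).
rewrite newton_remS.
have c := newton_coef_contiguous N.+1 f.
transitivity ((1 - q ^+ N.+2) *
  ((1 - q ^+ N.+1) * newton_rem N (fun t => (1 + t) * f t) -
   2 * (-1) ^+ N.+1 * (1 - q ^+ N.+1) *
      newton_coef N.+1 (fun t => (1 + t) * f t))).
  by ring.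
rewrite IH.
transitivity (2 * (-1) ^+ N.+2 *
  ((1 - q ^+ N.+1) * newton_coef N.+2 (fun t => (t - q ^+ N.+2) * f t)));
  last by ring.
rewrite c.
have -> : newton_coef N.+1 (fun t => (1 - q ^+ N.+1 * t) * f t) =
   (1 - q ^+ N.+1) * newton_coef N.+1 (fun t => (1 + t) * f t)
   + (- 1) * newton_coef N.+1 (fun t => (t - q ^+ N.+1) * f t).
  by rewrite -newton_coef_lin; apply: eq_newton_coef => k; ring.
by rewrite !exprS; ring.
Qed.

(** The remainder of [1 / (1 - s t)] is, up to a factor depending only on [s], the
    Blaschke product of the [(s - q^i) / (1 - q^i s)] times [(-1)^N]; this lemma is
    the recurrence between two consecutive products, freed from the kernel. *)
Lemma newton_rem_blaschke N f :
  newton_rem N.+1 (fun t => (t - q ^+ N.+1) * f t) =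
  - newton_rem N (fun t => (1 - q ^+ N.+1 * t) * f t).
Proof.
have -> : newton_rem N (fun t => (1 - q ^+ N.+1 * t) * f t) =
    (1 - q ^+ N.+1) * newton_rem N (fun t => (1 + t) * f t)
    + (- 1) * newton_rem N (fun t => (t - q ^+ N.+1) * f t).
  by rewrite -newton_rem_lin; apply: eq_newton_rem => t; ring.
by rewrite newton_remS newton_rem_factor; ring.
Qed.

Lemma newton_rem_cst N : newton_rem N (fun=> 1) = 0.
Proof.
elim: N => [|N IH]; first by rewrite newton_rem0 subrr.
by rewrite newton_remS IH newton_coef_cst // mulr0 subr0.
Qed.

Lemma newton_rem_exprS N j :
  newton_rem N.+1 (fun t => t ^+ j.+1) =
  q ^+ N.+1 * newton_rem N.+1 (fun t => t ^+ j)
  + q ^+ N.+1 * newton_rem N (fun t => t ^+ j.+1)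
  - newton_rem N (fun t => t ^+ j).
Proof.
have -> : newton_rem N.+1 (fun t => t ^+ j.+1) =
    1 * newton_rem N.+1 (fun t => (t - q ^+ N.+1) * t ^+ j)
    + q ^+ N.+1 * newton_rem N.+1 (fun t => t ^+ j).
  by rewrite -newton_rem_lin; apply: eq_newton_rem => t; rewrite (exprS t j); ring.
rewrite newton_rem_blaschke.
have -> : newton_rem N (fun t => (1 - q ^+ N.+1 * t) * t ^+ j) =
    1 * newton_rem N (fun t => t ^+ j)
    + - q ^+ N.+1 * newton_rem N (fun t => t ^+ j.+1).
  by rewrite -newton_rem_lin; apply: eq_newton_rem => t; rewrite (exprS t j); ring.
by ring.
Qed.

Context (w : R).
Hypothesis w_gt1 : 1 < w.

(** The recurrence [newton_rem_exprS] multiplies a bound of the form [M w^j] by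
    [(1 + w q^N) / (w - q^N)], which tends to [1 / w < 1]. *)
Definition rem_bound N : R :=
  2 * \prod_(1 <= n < N.+1) ((1 + w * q ^+ n) / (w - q ^+ n)).

Lemma rem_boundS N :
  rem_bound N.+1 * (w - q ^+ N.+1) = rem_bound N * (1 + w * q ^+ N.+1).
Proof.
have h : w - q ^+ N.+1 != 0.
  by rewrite subr_eq0 gt_eqF // (lt_trans _ w_gt1) // qX_lt1.
by rewrite /rem_bound big_nat_recr //=; field.
Qed.

Lemma rem_bound_ge0 N : 0 <= rem_bound N.
Proof.
rewrite mulr_ge0 // prodr_ge0 // => n _.
rewrite divr_ge0 //.
  by rewrite addr_ge0 // mulr_ge0 ?exprn_ge0 ?ltW // (lt_trans ltr01).
by rewrite subr_ge0 (le_trans _ (ltW w_gt1)) // exprn_ile1 ?ltW.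
Qed.

Lemma newton_rem_expr_le N j :
  `|newton_rem N (fun t => t ^+ j)| <= rem_bound N * w ^+ j.
Proof.
have w0 : 0 < w by rewrite (lt_trans ltr01).
elim: N j => [|N IHN] j.
  rewrite newton_rem0 expr1n /rem_bound big_geq // mulr1.
  have wj : 1 <= w ^+ j by rewrite exprn_ege1 // ltW.
  rewrite (le_trans (ler_normB _ _)) // normrX normrN1 expr1n normr1; lra.
elim: j => [|j IHj].
  by rewrite newton_rem_cst normr0 expr0 mulr1 rem_bound_ge0.
rewrite newton_rem_exprS.
have Q0 : 0 < q ^+ N.+1 by rewrite exprn_gt0.
apply: (le_trans (ler_normB _ _)); apply: (le_trans (lerD (ler_normD _ _) (lexx _))).
rewrite !normrM (gtr0_norm Q0).
have h1 := ler_wpM2l (ltW Q0) IHj.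
have h2 := ler_wpM2l (ltW Q0) (IHN j.+1).
apply: (le_trans (lerD (lerD h1 h2) (IHN j))).
(* the three majorants add up to exactly the claimed bound *)
have /eqP := rem_boundS N; rewrite -subr_eq0 => /eqP e.
rewrite -subr_ge0 !exprS.
suff -> : rem_bound N.+1 * (w * w ^+ j) -
   (q * q ^+ N * (rem_bound N.+1 * w ^+ j) +
    q * q ^+ N * (rem_bound N * (w * w ^+ j)) + rem_bound N * w ^+ j) =
   w ^+ j * (rem_bound N.+1 * (w - q ^+ N.+1) - rem_bound N * (1 + w * q ^+ N.+1)).
  by rewrite e mulr0.
by rewrite exprS; ring.
Qed.

End Interpolation.

(** * Limits of polynomials with nonnegative coefficients *)

Section PositivePolynomials.
Context {R : realType} (w : R).
Implicit Types (f g : R -> R).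

(** This stands for power series with nonnegative coefficients that converge at
    [w]: unlike these, it is stable under products for trivial reasons. *)
Definition pospoly_limit f := exists P : nat -> {poly R},
  (forall L j, 0 <= (P L)`_j) /\
  (forall t, `|t| <= w -> (P L).[t] @[L --> \oo] --> f t).

Lemma pospoly_limit_poly (p : {poly R}) :
  (forall j, 0 <= p`_j) -> pospoly_limit (horner p).
Proof. by move=> p0; exists (fun=> p); split=> // t _; exact: cvg_cst. Qed.

Lemma pospoly_limitM f g :
  pospoly_limit f -> pospoly_limit g -> pospoly_limit (fun t => f t * g t).
Proof.
move=> [P [P0 Pf]] [Q [Q0 Qg]]; exists (fun L => P L * Q L); split.
  by move=> L j; rewrite coefM sumr_ge0 // => i _; rewrite mulr_ge0.
by move=> t tw; under eq_fun do rewrite hornerM; apply: cvgM; [exact: Pf|exact: Qg].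
Qed.

Lemma pospoly_limit_prod (I : Type) (r : seq I) (F : I -> R -> R) :
  (forall i, pospoly_limit (F i)) ->
  pospoly_limit (fun t => \prod_(i <- r) F i t).
Proof.
move=> F_lim; elim: r => [|i r IH].
  rewrite (_ : (fun _ => _) = horner 1); last first.
    by apply/funext => t; rewrite big_nil hornerC.
  by apply: pospoly_limit_poly => j; rewrite coef1 ler0n.
under eq_fun do rewrite big_cons.
exact: pospoly_limitM.
Qed.

Lemma pospoly_limitX f n :
  pospoly_limit f -> pospoly_limit (fun t => f t ^+ n).
Proof.
move=> fl; rewrite (_ : (fun _ => _) = fun t => \prod_(i <- iota 0 n) f t).
  exact: pospoly_limit_prod.
by apply/funext => t; rewrite big_const_seq count_predT size_iota -Monoid.iteropE.
Qed.

Lemma pospoly_limit_affine (a b : R) :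
  0 <= a -> 0 <= b -> pospoly_limit (fun t => a + b * t).
Proof.
move=> a0 b0.
rewrite (_ : (fun _ => _) = horner (a%:P + b%:P * 'X)); last first.
  by apply/funext => t; rewrite !hornerE.
apply: pospoly_limit_poly => j.
by rewrite coefD coefC coefCM coefX addr_ge0 ?mulr_ge0 //; case: ifP.
Qed.

Lemma pospoly_limit_geometric (a : R) :
  0 <= a -> a * w < 1 -> pospoly_limit (fun t => (1 - a * t)^-1).
Proof.
move=> a0 aw1; exists (fun L => \poly_(j < L) a ^+ j); split.
  by move=> L j; rewrite coef_poly; case: ifP => // _; rewrite exprn_ge0.
move=> t tw.
have at1 : `|a * t| < 1.
  by rewrite normrM ger0_norm // (le_lt_trans _ aw1) // ler_wpM2l.
rewrite -[X in _ --> X]mul1r.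
rewrite (_ : (fun _ => _) = series (geometric 1 (a * t))); last first.
  apply/funext => L; rewrite horner_poly /series /= big_mkord.
  by apply: eq_bigr => j _; rewrite mul1r exprMn.
exact: cvg_geometric_series.
Qed.

End PositivePolynomials.

(** * Decay of the remainder *)

Section Remainder.
Context {R : realType} (q w : R).
Hypotheses (q_gt0 : 0 < q) (q_lt1 : q < 1) (w_gt1 : 1 < w) (wq_lt1 : w * q < 1).
Implicit Types (f : R -> R).

Lemma newton_rem_sum_expr N m (c : nat -> R) :
  newton_rem q N (fun t => \sum_(j < m) c j * t ^+ j) =
  \sum_(j < m) c j * newton_rem q N (fun t => t ^+ j).
Proof.
elim: m => [|m IH].
  rewrite big_ord0 -[RHS](mul0r (newton_rem q N (fun=> 0))).
  rewrite -[RHS]addr0 -[X in _ + X](mul0r (newton_rem q N (fun=> 0))).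
  rewrite -newton_rem_lin; apply: eq_newton_rem => t.
  by rewrite big_ord0 !mul0r addr0.
rewrite big_ord_recr /= -IH -[X in X + _]mul1r -newton_rem_lin.
by apply: eq_newton_rem => t; rewrite big_ord_recr /= mul1r.
Qed.

(** Nonnegativity of the coefficients lets the bounds [rem_bound N * w^j] of the
    monomials be reassembled into the value of the polynomial at [w]. *)
Lemma newton_rem_pospoly_le N (P : {poly R}) :
  (forall j, 0 <= P`_j) ->
  `|newton_rem q N (horner P)| <= rem_bound q w N * P.[w].
Proof.
move=> P0.
rewrite (eq_newton_rem q N _ _ (horner_coef P)) newton_rem_sum_expr horner_coef.
rewrite (le_trans (ler_norm_sum _ _ _)) // mulr_sumr ler_sum // => j _.
rewrite normrM ger0_norm // mulrCA ler_wpM2l //.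
exact: newton_rem_expr_le.
Qed.

(** For fixed [N] the remainder only involves finitely many values. *)
Lemma newton_rem_cvg N (g : nat -> R -> R) f :
  g L (-1) @[L --> \oo] --> f (-1) ->
  (forall k, g L (q ^+ k) @[L --> \oo] --> f (q ^+ k)) ->
  newton_rem q N (g L) @[L --> \oo] --> newton_rem q N f.
Proof.
move=> gm1 gq.
apply: cvgB; first by apply: cvgB => //; move: (gq 0); rewrite expr0.
apply: cvgM; first exact: cvg_cst.
apply: cvg_big; first exact: add_continuous.
move=> n _; apply: cvgM; first exact: cvg_cst.
apply: cvg_big; first exact: add_continuous.
by move=> k _; apply: cvgM; [exact: cvg_cst|exact: gq].
Qed.

Lemma newton_rem_pospoly_limit_le N f : pospoly_limit w f ->
  `|newton_rem q N f| <= rem_bound q w N * f w.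
Proof.
move=> [P [P0 Pf]].
have w0 : 0 <= w by rewrite (le_trans ler01) // ltW.
have lim1 : newton_rem q N (horner (P L)) @[L --> \oo] --> newton_rem q N f.
  apply: newton_rem_cvg => [|k]; apply: Pf.
    by rewrite normrN1 ltW.
  by rewrite ger0_norm ?exprn_ge0 ?(le_trans _ (ltW w_gt1)) // ?exprn_ile1 // ltW.
have lim2 : rem_bound q w N * (P L).[w] @[L --> \oo] --> rem_bound q w N * f w.
  by apply: cvgM; [exact: cvg_cst|apply: Pf; rewrite ger0_norm].
apply: (ler_cvg_to (cvg_norm lim1) lim2).
by apply: nearW => L; exact: newton_rem_pospoly_le.
Qed.

(** The factors are [1 + O(q^n)].  With [K] as below, [K (1 - q^N)] increases at
    each step by at least the logarithm of the new factor. *)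
Lemma prod_1Dwq_bounded : exists B : R, forall N,
  \prod_(1 <= n < N.+1) ((1 + w * q ^+ n) / (1 - w * q ^+ n)) <= B.
Proof.
have w0 : 0 < w by rewrite (lt_trans ltr01).
have d0 : 0 < 1 - w * q by rewrite subr_gt0.
have e0 : 0 < 1 - q by rewrite subr_gt0.
pose K := 2 * w * q / ((1 - w * q) * (1 - q)).
have K0 : 0 <= K by rewrite divr_ge0 ?mulr_ge0 // ltW.
exists (expR K) => N.
suff : \prod_(1 <= n < N.+1) ((1 + w * q ^+ n) / (1 - w * q ^+ n))
    <= expR (K * (1 - q ^+ N)).
  move=> /le_trans; apply; rewrite ler_expR.
  by rewrite ler_piMr // gerBl exprn_ge0 // ltW.
elim: N => [|N IH]; first by rewrite big_geq // expr0 subrr mulr0 expR0.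
rewrite big_nat_recr //=.
have qN : 0 < q ^+ N by rewrite exprn_gt0.
have qN1 : q ^+ N <= 1 by rewrite exprn_ile1 // ltW.
have x0 : 0 < w * q ^+ N.+1 by rewrite mulr_gt0 // exprn_gt0.
have xle : w * q ^+ N.+1 <= w * q.
  by rewrite ler_wpM2l ?(ltW w0) // exprSr ler_piMl // ltW.
have dN : 0 < 1 - w * q ^+ N.+1 by rewrite subr_gt0 (le_lt_trans xle).
have -> : K * (1 - q ^+ N.+1) = K * (1 - q ^+ N) + K * (1 - q) * q ^+ N.
  by rewrite exprS; ring.
rewrite expRD; apply: ler_pM => //.
- rewrite big_nat prodr_ge0 // => n /andP[n0 nN].
  have qn : q ^+ n <= q.
    by case: n n0 nN => // n _ _; rewrite exprSr ler_piMl ?exprn_ile1 ?ltW.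
  have xn : w * q ^+ n <= w * q by rewrite ler_wpM2l // ltW.
  rewrite divr_ge0 //; first by rewrite addr_ge0 // mulr_ge0 ?exprn_ge0 ?ltW.
  by rewrite subr_ge0 (le_trans xn) // ltW.
- by apply: divr_ge0; [apply: addr_ge0 => //|]; exact: ltW.
apply: le_trans (expR_ge1Dx _).
have -> : K * (1 - q) * q ^+ N = 2 * (w * q ^+ N.+1) / (1 - w * q).
  by rewrite /K exprS; field; rewrite !gt_eqF.
have -> : (1 + w * q ^+ N.+1) / (1 - w * q ^+ N.+1) =
   1 + 2 * (w * q ^+ N.+1) / (1 - w * q ^+ N.+1).
  by field; rewrite gt_eqF.
rewrite lerD2l; apply: ler_wpM2l; first by rewrite mulr_ge0 // ltW.
by rewrite lef_pV2 ?posrE // lerD2l lerN2.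
Qed.

(** Dividing each factor by [1 / w] leaves at most a factor of the bounded product
    above, so that the remainder bound is [O(w^-N)]. *)
Lemma rem_bound_cvg0 : rem_bound q w N @[N --> \oo] --> 0.
Proof.
have w0 : 0 < w by rewrite (lt_trans ltr01).
have [B HB] := prod_1Dwq_bounded.
have B0 : 0 <= B.
  by apply: le_trans (HB 0); rewrite big_geq.
apply: (squeeze_cvgr (f := fun=> 0) (h := fun N => 2 * B * w^-1 ^+ N)).
- apply: nearW => N; rewrite rem_bound_ge0 //= /rem_bound -mulrA.
  rewrite ler_wpM2l // mulrC.
  apply: (le_trans _ (ler_wpM2l _ (HB N))); last by rewrite exprn_ge0 // invr_ge0 ltW.
  rewrite -[X in _ ^+ X]card_ord -prodr_const.
  rewrite big_add1 big_mkord [X in _ * X]big_add1 big_mkord.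
  rewrite -big_split /= ler_prod // => -[n _] _ /=.
  have qn : q ^+ n.+1 <= q by rewrite exprSr ler_piMl ?exprn_ile1 ?ltW.
  have qn0 : 0 < q ^+ n.+1 by rewrite exprn_gt0.
  have a0 : 0 < 1 + w * q ^+ n.+1 by rewrite addr_gt0 // mulr_gt0.
  have b0 : 0 < w - q ^+ n.+1.
    by rewrite subr_gt0 (le_lt_trans qn) // (lt_trans q_lt1).
  have xn : w * q ^+ n.+1 <= w * q by rewrite ler_wpM2l // ltW.
  have c0 : 0 < 1 - w * q ^+ n.+1 by rewrite subr_gt0 (le_lt_trans xn).
  apply/andP; split; first by apply: divr_ge0; exact: ltW.
  rewrite mulrCA; apply: ler_wpM2l; first exact: ltW.
  rewrite -invfM lef_pV2 ?posrE ?mulr_gt0 //.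
  rewrite mulrBr mulr1 lerD2l lerN2 mulrA ler_peMl // ?ltW //.
  by rewrite -[X in X < _](mulr1 1) ltr_pM.
- exact: cvg_cst.
- rewrite -[X in _ --> X](mulr0 (2 * B)); apply: cvgM; first exact: cvg_cst.
  by apply: cvg_expr; rewrite ger0_norm ?invr_ge0 ?invf_lt1 // ltW.
Qed.

End Remainder.

Lemma cvg_expn {R : realType} (u : nat -> R) (l : R) n :
  u M @[M --> \oo] --> l -> u M ^+ n @[M --> \oo] --> l ^+ n.
Proof.
move=> ul; apply: (@cvg_comp _ _ _ u (fun x => x ^+ n) _ _ _ ul).
exact: exprn_continuous.
Qed.

(** * The interpolated infinite product *)

Section ProductFunctions.
Context {R : realType} (q : R).
Hypotheses (q_gt0 : 0 < q) (q_lt1 : q < 1).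
Implicit Types (x t : R).

Definition qpoch_ratio x M t : R :=
  \prod_(1 <= i < M.+1) ((1 - x * q ^+ i * t) / (1 - x * q ^+ i)).

Lemma qX_cvg0 k : q ^+ (M + k) @[M --> \oo] --> 0.
Proof.
rewrite (cvg_shiftn k (fun M => q ^+ M)).
by apply: cvg_expr; rewrite gtr0_norm.
Qed.

Lemma one_minus_neq0 x i : `|x| <= 1 -> (0 < i)%N -> 1 - x * q ^+ i != 0.
Proof.
move=> x1 i0; rewrite subr_eq0 eq_sym; apply/eqP => /(congr1 Num.norm).
apply/eqP; rewrite normr1 lt_eqF // normrM (gtr0_norm (exprn_gt0 i q_gt0)).
rewrite (le_lt_trans _ (qX_lt1 q q_gt0 q_lt1 i i0)) // ler_piMl //.
by rewrite exprn_ge0 // ltW.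
Qed.

Lemma qpoch_ratio_shift x M k : `|x| <= 1 ->
  (1 - x * q ^+ k.+1) * qpoch_ratio x M (q ^+ k.+1) =
  (1 - x * q ^+ (M + k.+1)) * qpoch_ratio x M (q ^+ k).
Proof.
move=> x1; rewrite /qpoch_ratio; elim: M => [|M IH].
  by rewrite add0n !big_geq.
rewrite !(big_nat_recr M.+1) //= mulrA IH.
have n0 := one_minus_neq0 x M.+1 x1 isT.
rewrite -!(mulrA x) -!exprD.
have -> : (M.+1 + k = M + k.+1)%N by rewrite addnS.
by field.
Qed.

(** Passing from [q^k] to [q^(k+1)] shifts all the factors by one place, so the
    ratio telescopes to a last factor, tending to 1, over a first one. *)
Lemma qpoch_ratio_cvg x k : `|x| <= 1 ->
  qpoch_ratio x M (q ^+ k) @[M --> \oo] --> (qpoch (x * q) q k)^-1.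
Proof.
move=> x1; elim: k => [|k IH].
  rewrite qpoch0 invr1; under eq_fun => M.
    rewrite /qpoch_ratio big_nat_cond big1; last first.
      by move=> i /andP[/andP[i0 _] _]; rewrite mulr1 divff // one_minus_neq0.
    over.
  exact: cvg_cst.
have n0 := one_minus_neq0 x k.+1 x1 isT.
rewrite qpochSr -mulrA -exprS invfM mulrC.
rewrite (_ : (fun _ => _) = fun M => (1 - x * q ^+ k.+1)^-1 *
    ((1 - x * q ^+ (M + k.+1)) * qpoch_ratio x M (q ^+ k))); last first.
  by apply/funext => M; rewrite -qpoch_ratio_shift // mulKf.
apply: cvgM; first exact: cvg_cst.
rewrite -[X in _ --> X]mul1r; apply: cvgM => //.
rewrite -[X in _ --> X]subr0 -[X in _ --> _ - X](mulr0 x).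
apply: cvgB; first exact: cvg_cst.
by apply: cvgM; [exact: cvg_cst|exact: qX_cvg0].
Qed.

Definition gauss_prod M : R := \prod_(1 <= n < M.+1) ((1 - q ^+ n) / (1 + q ^+ n)).

Lemma gauss_prod_cvg : exists P : R, gauss_prod M @[M --> \oo] --> P.
Proof.
have term n : 0 <= (1 - q ^+ n) / (1 + q ^+ n) <= 1.
  have h0 : 0 <= q ^+ n by rewrite exprn_ge0 // ltW.
  have h1 : q ^+ n <= 1 by rewrite exprn_ile1 // ltW.
  have d0 : 0 < 1 + q ^+ n by rewrite ltr_wpDr.
  by rewrite divr_ge0 ?subr_ge0 ?(ltW d0) //= ler_pdivrMr // mul1r; lra.
have ge0 M : 0 <= gauss_prod M.
  by apply: prodr_ge0 => n _; have /andP[] := term n.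
exists (inf (range gauss_prod)); apply: nonincreasing_cvgn.
  apply/nonincreasing_seqP => M; rewrite /gauss_prod big_nat_recr //=.
  by rewrite ler_piMr ?ge0 //; have /andP[] := term M.+1.
by exists 0 => _ [M _ <-].
Qed.

(** The partial products of the function to be interpolated: with [x = -1] and
    [x = 1] the ratios are those of [(-tq;q)_M] and [(tq;q)_M] to their values at
    [t = 1]. *)
Definition interpolant (c d : nat) M t : R :=
  qpoch_ratio (-1) M t ^+ c / qpoch_ratio 1 M t ^+ d.

Lemma interpolantN1 c d M : interpolant c d M (-1) = gauss_prod M ^+ (c + d).
Proof.
rewrite /interpolant exprD -exprVn /qpoch_ratio -prodfV.
by congr (_ ^+ _ * _ ^+ _); apply: eq_big_nat => n _;
  rewrite ?invf_div ?mulN1r ?mul1r mulrN1 !opprK.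
Qed.

Lemma interpolant_cvg c d k : interpolant c d M (q ^+ k) @[M --> \oo] -->
  qpoch q q k ^+ d / qpoch (- q) q k ^+ c.
Proof.
have r1 := qpoch_ratio_cvg 1 k; have rN1 := qpoch_ratio_cvg (-1) k.
rewrite mul1r normr1 in r1; rewrite mulN1r normrN1 in rN1.
rewrite mulrC -exprVn -[X in _ * X]invrK -(exprVn (qpoch q q k)).
apply: cvgM; first exact: cvg_expn (rN1 (lexx 1)).
apply: cvgV; first by rewrite expf_neq0 // invr_eq0 qpochqq_neq0.
exact: cvg_expn (r1 (lexx 1)).
Qed.

Lemma radius_exists : exists2 w : R, 1 < w & w * q < 1.
Proof.
have s0 : 0 < 1 + q by rewrite addr_gt0.
have q1 := q_lt1.
exists (2 / (1 + q)); first by rewrite ltr_pdivlMr // mul1r; lra.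
by rewrite mulrAC ltr_pdivrMr // mul1r; lra.
Qed.

Section Radius.
Variable w : R.
Hypotheses (w_gt1 : 1 < w) (wq_lt1 : w * q < 1).

Let w0 : 0 < w.
Proof. by rewrite (lt_trans ltr01). Qed.

Let qi i : (0 < i)%N -> 0 < q ^+ i /\ w * q ^+ i < 1.
Proof.
case: i => // i _; split; first by rewrite exprn_gt0.
apply: le_lt_trans wq_lt1; rewrite ler_wpM2l ?(ltW w0) //.
by rewrite exprSr ler_piMl ?exprn_ile1 // ltW.
Qed.

Lemma interpolant_pospoly_limit c d M : pospoly_limit w (interpolant c d M).
Proof.
rewrite (_ : interpolant c d M = fun t =>
    (\prod_(0 <= i < M)
       ((1 + q ^+ i.+1)^-1 + q ^+ i.+1 / (1 + q ^+ i.+1) * t)) ^+ c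
    * (\prod_(0 <= i < M)
         ((1 - q ^+ i.+1 + 0 * t) * (1 - q ^+ i.+1 * t)^-1)) ^+ d).
  apply: pospoly_limitM; apply: pospoly_limitX; apply: pospoly_limit_prod => i.
    by apply: pospoly_limit_affine;
      rewrite ?divr_ge0 ?invr_ge0 ?addr_ge0 ?exprn_ge0 ?ltW.
  have [qi0 qi1] := qi i.+1 isT.
  apply: pospoly_limitM.
    by apply: pospoly_limit_affine; rewrite // subr_ge0 ltW // qX_lt1.
  by apply: pospoly_limit_geometric; [exact: ltW|rewrite mulrC].
apply/funext => t; rewrite /interpolant -exprVn /qpoch_ratio -prodfV !big_add1 /=.
congr (_ ^+ _ * _ ^+ _); apply: eq_bigr => i _.
  by rewrite !mulN1r !mulNr !opprK mulrDl mul1r mulrAC.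
by rewrite invf_div mul0r addr0 !mul1r.
Qed.

(** At [w] each of the [c + d] elementary factors with index [i] is at most
    [(1 + w q^i) / (1 - w q^i)]. *)
Lemma interpolant_radius_le c d B M :
  (forall N, \prod_(1 <= n < N.+1) ((1 + w * q ^+ n) / (1 - w * q ^+ n)) <= B) ->
  interpolant c d M w <= B ^+ (c + d).
Proof.
move=> HB.
pose D := \prod_(1 <= n < M.+1) ((1 + w * q ^+ n) / (1 - w * q ^+ n)).
have le1 : 0 <= qpoch_ratio (-1) M w <= D.
  rewrite /qpoch_ratio /D !big_add1 !big_mkord.
  apply/andP; split.
    apply: prodr_ge0 => i _; have [qi0 qi1] := qi i.+1 isT.
    rewrite !mulN1r mulNr !opprK.
    by rewrite divr_ge0 ?addr_ge0 ?mulr_ge0 ?(ltW qi0) ?(ltW w0).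
  apply: ler_prod => i _; have [qi0 qi1] := qi i.+1 isT.
  rewrite !mulN1r mulNr !opprK (mulrC (q ^+ _)).
  have n0 : 0 < w * q ^+ i.+1 by rewrite mulr_gt0.
  have a0 : 0 < 1 + w * q ^+ i.+1 by rewrite addr_gt0.
  apply/andP; split; first by rewrite divr_ge0 ?(ltW a0) ?addr_ge0 ?(ltW qi0).
  apply: ler_wpM2l; first exact: ltW.
  rewrite lef_pV2 ?posrE ?subr_gt0 // ?addr_gt0 //; lra.
have le2 : 0 <= (qpoch_ratio 1 M w)^-1 <= D.
  rewrite /qpoch_ratio /D -prodfV !big_add1 !big_mkord.
  have h (i : nat) : 0 <= ((1 - 1 * q ^+ i.+1 * w) / (1 - 1 * q ^+ i.+1))^-1
      <= (1 + w * q ^+ i.+1) / (1 - w * q ^+ i.+1).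
    have [qi0 qi1] := qi i.+1 isT.
    have n0 : 0 < w * q ^+ i.+1 by rewrite mulr_gt0.
    have d0 : 0 < 1 - w * q ^+ i.+1 by rewrite subr_gt0.
    have q1 : 0 < 1 - q ^+ i.+1 by rewrite subr_gt0 qX_lt1.
    rewrite invf_div !mul1r (mulrC (q ^+ _)).
    apply/andP; split; first by apply: divr_ge0; exact: ltW.
    apply: ler_wpM2r; first by rewrite invr_ge0 ltW.
    by rewrite lerD2l; lra.
  apply/andP; split; first by apply: prodr_ge0 => i _; have /andP[] := h i.
  by apply: ler_prod => i _.
have B0 : 0 <= B by apply: le_trans (HB 0%N); rewrite big_geq.
move/andP: le1 => [x0 xD]; move/andP: le2 => [y0 yD].
rewrite /interpolant exprD -exprVn; apply: ler_pM; rewrite ?exprn_ge0 //.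
  by rewrite lerXn2r ?nnegrE // (le_trans xD) // HB.
by rewrite lerXn2r ?nnegrE // (le_trans yD) // HB.
Qed.

End Radius.

(** The interpolation formula at -1 for the infinite product.  The remainder bound
    holds for each partial product, uniformly in [M]; it passes to the limit
    [M -> oo] at fixed [N], after which [N -> oo]. *)
Lemma qhyper_series_cvg c d (P : R) :
  gauss_prod M @[M --> \oo] --> P ->
  1 + 2 * \sum_(1 <= n < N.+1) (-1) ^+ n *
     \sum_(k < n.+1) newton_weight q n k * (qpoch q q k ^+ d / qpoch (- q) q k ^+ c)
  @[N --> \oo] --> P ^+ (c + d).
Proof.
move=> cvgP.
have [w w1 wq1] := radius_exists.
pose F t := limn ((interpolant c d)^~ t).
have FN1 : F (-1) = P ^+ (c + d).
  apply: cvg_lim => //; under eq_fun do rewrite interpolantN1.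
  exact: cvg_expn.
have Fq k : F (q ^+ k) = qpoch q q k ^+ d / qpoch (- q) q k ^+ c.
  by apply: cvg_lim => //; exact: interpolant_cvg.
have [B HB] := prod_1Dwq_bounded q w q_gt0 q_lt1 w1 wq1.
have remM N M : `|newton_rem q N (interpolant c d M)| <= rem_bound q w N * B ^+ (c + d).
  have lim := interpolant_pospoly_limit w w1 wq1 c d M.
  apply: (le_trans (newton_rem_pospoly_limit_le q w _ _ _ _ _ lim)) => //.
  apply: ler_wpM2l; first exact: rem_bound_ge0.
  exact: interpolant_radius_le.
have remF N : `|newton_rem q N F| <= rem_bound q w N * B ^+ (c + d).
  have lim : newton_rem q N (interpolant c d M) @[M --> \oo] --> newton_rem q N F.
    apply: newton_rem_cvg => [|k].
      under eq_fun do rewrite interpolantN1.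
      by rewrite FN1; exact: cvg_expn.
    by rewrite Fq; exact: interpolant_cvg.
  apply: (cvgr_to_le (cvg_norm lim)).
  by apply: nearW => M; exact: remM.
have rem0 : newton_rem q N F @[N --> \oo] --> 0.
  apply: norm_cvg0.
  apply: (squeeze_cvgr (f := fun=> 0) (h := fun N => rem_bound q w N * B ^+ (c + d))).
  - by apply: nearW => N; rewrite normr_ge0 remF.
  - exact: cvg_cst.
  - rewrite -[X in _ --> X](mul0r (B ^+ (c + d))).
    by apply: cvgM; [exact: rem_bound_cvg0|exact: cvg_cst].
have -> : (fun N => 1 + 2 * \sum_(1 <= n < N.+1) (-1) ^+ n *
     \sum_(k < n.+1) newton_weight q n k * (qpoch q q k ^+ d / qpoch (- q) q k ^+ c))
  = (fun N => P ^+ (c + d) - newton_rem q N F).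
  apply/funext => N; rewrite /newton_rem FN1.
  have -> : F 1 = 1 by rewrite -[X in F X](expr0 q) Fq !qpoch0 !expr1n divr1.
  rewrite (eq_bigr (fun n => (-1) ^+ n * newton_coef q n F)); first by ring.
  by move=> n _; congr (_ * _); apply: eq_bigr => k _; rewrite Fq.
rewrite -[X in _ --> X]subr0.
by apply: cvgB => //; exact: cvg_cst.
Qed.

End ProductFunctions.

(** * The two families of coefficients *)

Section Vandermonde.
Context {R : realType} (q : R).
Hypotheses (q_gt0 : 0 < q) (q_lt1 : q < 1).

(** The sum is the expansion of [b^n] in the basis of the [(b;q)_k]: multiplying
    [(b;q)_k] by [b] produces [q^-k ((b;q)_k - (b;q)_(k+1))], and the coefficients
    satisfy the same recurrence in [n]. *)
Lemma q_vandermonde0 n (b : R) :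
  \sum_(k < n.+1) qpoch (q ^- n) q k / qpoch q q k * q ^+ k * qpoch b q k
  = b ^+ n.
Proof.
have q0 : q != 0 by rewrite gt_eqF.
have Q0 := qpochqq_neq0 q q_gt0 q_lt1.
pose c n k := qpoch (q ^- n) q k / qpoch q q k * q ^+ k.
have c0 m k : (m < k)%N -> c m k = 0.
  by move=> mk; rewrite /c qpoch_eq0 // !mul0r.
have crec m k : c m.+1 k.+1 = c m k.+1 * q ^- k.+1 - c m k * q ^- k.
  rewrite /c [qpoch (q ^- m.+1) _ _]qpochSl [qpoch (q ^- m) _ k.+1]qpochSr.
  have -> : q ^- m.+1 * q = q ^- m by rewrite exprSr; field; rewrite expf_neq0.
  have := Q0 k.+1; rewrite qpochSr mulf_eq0 negb_or => /andP[Ck Sk].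
  rewrite (exprS q k) (exprS q m).
  have := expf_neq0 k q0; have := expf_neq0 m q0; move: Ck Sk.
  move: (qpoch q q k) (qpoch (q ^- m) q k) (q ^+ k) (q ^+ m) => C A x y *.
  by field; apply/and5P.
elim: n => [|n IH].
  by rewrite big_ord1 !qpoch0 !expr0 divr1 !mulr1.
rewrite (exprSr b) -IH mulr_suml.
have step k : qpoch b q k * b = q ^- k * (qpoch b q k - qpoch b q k.+1).
  by rewrite qpochSr; field; rewrite expf_neq0.
under [RHS]eq_bigr => k _ do rewrite -mulrA step.
rewrite -[LHS]/(\sum_(k < n.+2) c n.+1 k * qpoch b q k) big_ord_recl.
under [X in _ + X = _]eq_bigr => k _ do rewrite lift0 crec mulrBl.
rewrite sumrB addrA big_ord_recr /= (c0 n n.+1) // !mul0r addr0.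
under [RHS]eq_bigr => k _ do rewrite mulrA mulrBr.
rewrite sumrB; congr (_ - _).
rewrite [RHS]big_ord_recl; congr (_ + _).
by rewrite /c !qpoch0 !expr0; field.
Qed.

Lemma newton_sum_gauss n :
  \sum_(k < n.+1) newton_weight q n k * (qpoch q q k ^+ 1 / qpoch (- q) q k ^+ 0)
  = q ^+ (n * n).
Proof.
rewrite exprM -q_vandermonde0; apply: eq_bigr => k _.
rewrite /newton_weight expr1 expr0.
by field; exact: qpochqq_neq0.
Qed.

Lemma qhyper_newton_sum m n :
  qhyper n [tuple of q ^+ n :: nseq m q] [tuple of - q :: nseq m 0] q q =
  \sum_(k < n.+1) newton_weight q n k * (qpoch q q k ^+ m.+1 / qpoch (- q) q k ^+ 1).
Proof.
apply: eq_bigr => k _; rewrite /= !big_cons !big_nseq.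
have iterE (x : R) : iter m ( *%R x) 1 = x ^+ m by rewrite -Monoid.iteropE.
rewrite !iterE qpoch_0l expr1n mulr1 /newton_weight expr1 !invfM exprS.
have Ck := qpochqq_neq0 q q_gt0 q_lt1 k.
move: (qpoch (- q) q k)^-1 (qpoch q q k ^+ m) => x y.
by field.
Qed.

End Vandermonde.

(** * Theta series and conclusion *)

Lemma bilateral_sum_even (R : realType) (f : int -> R) (s : R) :
  (forall n, f (- n) = f n) ->
  \sum_(1 <= n < N.+1) f n%:Z @[N --> \oo] --> s ->
  has_bilateral_sum f (f 0 + 2 * s).
Proof.
move=> f_even fs.
have -> : f 0 + 2 * s = s + (f 0 + s) by ring.
rewrite /has_bilateral_sum; apply: cvgD.
  apply: (@cvg_comp _ _ _ fst (fun M => \sum_(i < M) f (- i.+1%:Z)) _ \oo).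
    exact: cvg_fst.
  apply: cvg_trans fs; apply: near_eq_cvg; apply: nearW => M.
  by rewrite big_add1 big_mkord; apply: eq_bigr => i _; rewrite f_even.
apply: (@cvg_comp _ _ _ snd (fun M => \sum_(i < M) f i%:Z) _ \oo).
  exact: cvg_snd.
rewrite -cvg_shiftS.
apply: cvg_trans (cvgD (cvg_cst (f 0)) fs); apply: near_eq_cvg.
apply: nearW => M; rewrite -[LHS]/(f 0 + \sum_(1 <= n < M.+1) f n%:Z) /=.
by rewrite big_ord_recl big_add1 big_mkord.
Qed.

Theorem proposition3p8 (R : realType) (m : nat) (q : R) (q_gt0 : 0 < q)
    (q_lt1 : q < 1) :
  exists theta P S : R,
    [/\ has_bilateral_sum (fun n : int => (-1) ^ n * q ^ (n * n)) theta,
        \prod_(1 <= n < N.+1) ((1 - q ^+ n) / (1 + q ^+ n)) ^+ (m + 2)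
          @[N --> \oo] --> P,
        \sum_(1 <= n < N.+1)
           (-1) ^+ n * qhyper n [tuple of q ^+ n :: nseq m q]
                                [tuple of - q :: nseq m 0] q q
          @[N --> \oo] --> S,
        theta ^+ (m + 2) = P
      & P = 1 + 2 * S].
Proof.
have [theta cvg_theta] := gauss_prod_cvg q q_gt0 q_lt1.
have half (u : nat -> R) l : 1 + 2 * u N @[N --> \oo] --> l ->
    u N @[N --> \oo] --> (l - 1) / 2.
  move=> ul; rewrite (_ : u = fun N => (1 + 2 * u N - 1) / 2).
    by apply: cvgM; [apply: cvgB => //; exact: cvg_cst|exact: cvg_cst].
  by apply/funext => N; field.
exists theta, (theta ^+ (m + 2)), ((theta ^+ (m + 2) - 1) / 2).
split=> //.
- have -> : theta = 1 + 2 * ((theta - 1) / 2) by field.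
  have := @bilateral_sum_even R (fun n => (-1) ^ n * q ^ (n * n)) ((theta - 1) / 2).
  rewrite mulr0 !expr0z mulr1; apply.
    by move=> n; rewrite mulrNN -exprz_inv invrN1.
  (* Gauss: no factor [1 + q^i t] and one factor [1 / (1 - q^i t)] *)
  have := qhyper_series_cvg q q_gt0 q_lt1 0 1 theta cvg_theta.
  rewrite expr1 => /half.
  by under eq_fun do under eq_bigr do rewrite newton_sum_gauss //.
- under eq_fun do rewrite prodrXl.
  exact: cvg_expn.
- under eq_fun do under eq_bigr do rewrite qhyper_newton_sum //.
  apply: half; have := qhyper_series_cvg q q_gt0 q_lt1 1 m.+1 theta cvg_theta.
  have -> : (1 + m.+1 = m + 2)%N by rewrite add1n addn2.
  by [].
- by field.
Qed.
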